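(* Let $G=([n],E)$ be an arbitrary graph with a fixed total ordering $\lessdot$ of $E$. Then the chromatic symmetric function satisfies $$X_G(\mathbf x)=\sum_{\mathcal F\in\mathrm{FT}(G)}\mathrm{sign}(\mathcal F)\,e_{\mathrm{type}(\mathcal F)}=\sum_\mu\Big(\sum_{\mathcal F\in\mathrm{FT}_\mu(G)}\mathrm{sign}(\mathcal F)\Big)e_\mu .$$ In particular, this $e$-expansion does not depend on the choice of total ordering $\lessdot$.
   Context: $X_G(\mathbf x)=\sum_\kappa x_{\kappa(1)}\cdots x_{\kappa(n)}$, summed over proper colourings $\kappa:[n]\to\{1,2,\dots\}$ ($\kappa(i)\ne\kappa(j)$ for $\{i,j\}\in E$); $e_\mu=\prod_ie_{\mu_i}$ with $e_k$ the elementary symmetric functions. A no-broken-circuit (NBC) tree of $G$ is a subgraph $T$ of $G$ which is a tree (nonempty vertex set) such that $E(T)$ contains no set of the form $C\setminus\{\max C\}$, where $C\subseteq E$ is the edge set of a cycle and $\max C$ is its largest edge under $\lessdot$. A tree triple is $(T,\alpha,r)$ with $T$ an NBC tree, $\alpha=\alpha_1\cdots\alpha_\ell$ an integer composition of $|V(T)|$, and $1\le r\le\alpha_1$. A forest triple is a sequence $\mathcal F=((T_i,\alpha^{(i)},r_i))_{i=1}^m$ of tree triples such that each vertex lies in exactly one $T_i$ and $\min V(T_1)<\dots<\min V(T_m)$. $\mathrm{type}(\mathcal F)$ is the partition obtained by sorting the parts of $\alpha^{(1)}\cdots\alpha^{(m)}$ in decreasing order; $\mathrm{sign}(\mathcal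 F)=(-1)^{\sum_i(\ell(\alpha^{(i)})-1)}$. $\mathrm{FT}(G)$ is the set of forest triples and $\mathrm{FT}_\mu(G)$ those of type $\mu$. *)

(* Defs.v *)
From HB Require Import structures.
From mathcomp Require Import all_boot all_order all_algebra.
From mathcomp Require Import finmap multiset.
From mathcomp Require Import boolp classical_sets functions cardinality fsbigop.

Set Implicit Arguments.
Unset Strict Implicit.
Unset Printing Implicit Defensive.

Import Order.TTheory GRing.Theory Num.Theory.

Local Open Scope ring_scope.

(* Formal power series over the integers in countably many commuting          *)
(* variables. The variables are indexed by nat, starting from 0, so that      *)
(* 'x_i below is the variable usually called x_(i+1). A monomial is a finite  *)
(* multiset of indices, and a series is the function giving the coefficient   *)
(* of each monomial. The alias keeps the Cauchy product away from the         *)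
(* pointwise product that the library puts on functions into a ring.          *)
Notation monomial := {mset nat}%mset.

Definition fps : Type := monomial -> int.

HB.instance Definition _ := GRing.Zmodule.copy fps (monomial -> int).

Definition monomial_splits (m : monomial) : set (monomial * monomial) :=
  [set ab | (ab.1 `+` ab.2)%mset = m]%classic.

Definition fps_one : fps := fun m => (m == mset0)%:R.

Definition fps_mul (f g : fps) : fps :=
  fun m => \sum_(ab \in monomial_splits m) f ab.1 * g ab.2.

Fixpoint submsets (s : seq nat) : seq monomial :=
  if s is x :: s' then submsets s' ++ [seq (x +` A)%mset | A <- submsets s']
  else [:: mset0].

Lemma mem_submsets (s : seq nat) (A : monomial) :
  (A `<=` seq_mset s)%mset -> A \in submsets s.
Proof.
elim: s A => [|x s IHs] A /=.
  move=> /msubsetP sA; rewrite inE; apply/mset_eqP => a.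
  by have := sA a; rewrite mset_seqE /= mset0E leqn0 => /eqP.
move=> sA; rewrite mem_cat; apply/orP.
have [xA|xA] := boolP (x \in A).
  right; apply/mapP; exists (A `\ x)%mset; last by rewrite msetB1K.
  apply: IHs; apply/msubsetP => a; move/msubsetP/(_ a): sA.
  by rewrite msetB1E !mset_seqE /= (eq_sym a) leq_subLR.
left; apply: IHs; apply/msubsetP => a; move/msubsetP/(_ a): sA.
rewrite !mset_seqE /=; have [<-|//] := eqVneq x a.
by move/mset_eq0P: xA => ->.
Qed.

Lemma monomial_splits_finite (m : monomial) : finite_set (monomial_splits m).
Proof.
apply: (@sub_finite_set _ _
  [set` [seq (A, (m `\` A)%mset) | A <- submsets (enum_mset m)]]%classic).
  move=> [A B] /= <-; apply/mapP; exists A.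
    by apply: mem_submsets; rewrite seq_mset_id -[X in msubset X]msetD0; apply: msetDS; apply: msub0set.
  by rewrite msetDKB.
exact: finite_seq.
Qed.

Lemma fps_mulE (f g : fps) (m : monomial) :
  fps_mul f g m = \sum_(ab <- fset_set (monomial_splits m)) f ab.1 * g ab.2.
Proof. by rewrite /fps_mul fsbig_finite//; exact: monomial_splits_finite. Qed.

Lemma mem_monomial_splits (m : monomial) ab :
  (ab \in fset_set (monomial_splits m)) = ((ab.1 `+` ab.2)%mset == m).
Proof.
rewrite in_fset_set; last exact: monomial_splits_finite.
by apply/idP/eqP; rewrite inE.
Qed.

Lemma fps_mulC : commutative fps_mul.
Proof.
move=> f g; apply/funext => m.
rewrite /fps_mul (reindex_fsbig (fun ab => (ab.2, ab.1)) (monomial_splits m)).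
  by apply: eq_fsbigr => ab _; rewrite mulrC.
split=> [[a b] /= <-|[a b] [c d] _ _ [-> ->]//|[a b] /= <-].
  by rewrite /monomial_splits /= msetDC.
by exists (b, a); rewrite /monomial_splits /= 1?msetDC.
Qed.

Lemma fps_mulDl : left_distributive fps_mul +%R.
Proof.
move=> f g h; apply/funext => m; rewrite [RHS]/GRing.add /= !fps_mulE.
by rewrite -big_split; apply: eq_bigr => ab _; rewrite mulrDl.
Qed.

Lemma fps_mul1 : left_id fps_one fps_mul.
Proof.
move=> f; apply/funext => m; rewrite fps_mulE (bigD1_seq (mset0, m)) //=.
- rewrite /fps_one eqxx mul1r big1_seq ?addr0// => -[a b] /=.
  rewrite mem_monomial_splits => /andP[ab0 /eqP/= abm].
  have [a0|] := eqVneq a mset0; last by rewrite mul0r.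
  by move: ab0 abm; rewrite a0 mset0D => /[swap] ->; rewrite eqxx.
- by rewrite mem_monomial_splits /= mset0D.
- exact: fset_uniq.
Qed.

Lemma fps_mulA : associative fps_mul.
Proof.
suff mulA f g h m : fps_mul (fps_mul f g) h m = fps_mul f (fps_mul g h) m.
  by move=> f g h; apply/funext => m; rewrite mulA.
pose D m := enum_fset (fset_set (monomial_splits m)).
have memD n ab : (ab \in D n) = ((ab.1 `+` ab.2)%mset == n).
  exact: mem_monomial_splits.
have uD n : uniq (D n) by exact: fset_uniq.
pose T (t : monomial * monomial * monomial) := f t.1.1 * g t.1.2 * h t.2.
transitivity (\sum_(t <- [seq (q, p.2) | p <- D m, q <- D p.1]) T t).
  rewrite big_allpairs_dep fps_mulE; apply: eq_bigr => p _.
  by rewrite fps_mulE mulr_suml.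
transitivity (\sum_(t <- [seq ((p.1, q.1), q.2) | p <- D m, q <- D p.2]) T t).
  apply/perm_big/uniq_perm.
  - apply: allpairs_uniq_dep => // -[a b] [a' b'] /allpairsPdep[p [q [pm qp ->]]].
    move=> /allpairsPdep[p' [q' [pm' qp' ->]]] /= [eq2 eq3].
    move: pm qp pm' qp'; rewrite !memD eq2 => _ /eqP q1 _ /eqP q1'.
    by move: eq3 q1 q1'; case: p p' => [? ?] [? ?] /= -> <- <-.
  - apply: allpairs_uniq_dep => // -[a b] [a' b'] /allpairsPdep[p [q [pm qp ->]]].
    move=> /allpairsPdep[p' [q' [pm' qp' ->]]] /= [eq1 eq2 eq3].
    move: qp qp'; rewrite !memD eq2 eq3 => /eqP q1 /eqP q1'.
    case: p p' pm pm' eq1 q1 q1' => [? ?] [? ?] _ _ /= -> <- <-.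
    by case: q q' eq2 eq3 => [? ?] [? ?] /= -> ->.
  - move=> [[a b] c]; apply/allpairsPdep/allpairsPdep => -[p [q]] [].
    + rewrite !memD => /eqP pm /eqP qp [ab cp].
      exists (a, b `+` c)%mset, (b, c); rewrite !memD /= eqxx; split=> //.
      by rewrite msetDA cp -pm -qp -ab.
    + rewrite !memD => /eqP pm /eqP qp [-> -> ->].
      exists (p.1 `+` q.1, q.2)%mset, (p.1, q.1); rewrite !memD /= eqxx.
      by split=> //; rewrite -msetDA qp pm.
rewrite big_allpairs_dep fps_mulE; apply: eq_bigr => p _.
by rewrite fps_mulE mulr_sumr; apply: eq_bigr => q _; rewrite /T mulrA.
Qed.

Lemma fps_one_neq0 : fps_one != 0.
Proof.
by apply/eqP => /(congr1 (fun f : fps => f mset0)); rewrite /fps_one eqxx.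
Qed.

HB.instance Definition _ := GRing.Zmodule_isComNzRing.Build fps
  fps_mulA fps_mulC fps_mul1 fps_mulDl fps_one_neq0.

Definition fps_var (i : nat) : fps := fun m => (m == [mset i]%mset)%:R.

Notation "''x_' i" := (fps_var i)
  (at level 8, i at level 2, format "''x_' i") : ring_scope.

(* The sum of a possibly infinite family of power series, computed            *)
(* coefficient by coefficient. It is meaningful for the families in which     *)
(* each monomial occurs finitely often; the two families summed below have    *)
(* this property (chromatic_sum_locally_finite, esym_locally_finite).         *)
Definition locally_finite (I : choiceType) (A : set I) (f : I -> fps) :=
  forall m, finite_set (A `&` [set i | f i m <> 0])%classic.

Definition fps_sum (I : choiceType) (A : set I) (f : I -> fps) : fps :=
  fun m => \sum_(i \in A) f i m.

Lemma prod_fps_var (s : seq nat) :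
  \prod_(i <- s) 'x_i = (fun m => (m == seq_mset s)%:R) :> fps.
Proof.
elim: s => [|i s IHs].
  rewrite big_nil; apply/funext => m; congr (_ == _)%:R.
  by apply/msetP => a; rewrite mset_seqE mset0E.
rewrite big_cons IHs; apply/funext => m; rewrite [LHS]fps_mulE mset_cons.
rewrite (eq_bigr (fun ab => (ab == ([mset i], seq_mset s)%mset)%:R)); last first.
  by move=> [a b] _; rewrite /fps_var xpair_eqE /= -natrM mulnb.
have [->|ne] := eqVneq m (i +` seq_mset s)%mset.
  rewrite (bigD1_seq ([mset i], seq_mset s)%mset) /= ?fset_uniq//.
    by rewrite eqxx big1 ?addr0// => ab /negPf ->.
  by rewrite mem_monomial_splits.
rewrite big1_seq// => ab /= /[!mem_monomial_splits] /eqP abm.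
by case: eqP => // e; move: abm ne; rewrite e => ->; rewrite eqxx.
Qed.

Definition esym (k : nat) : fps :=
  fps_sum [set S : {fset nat} | #|` S|%fset = k]%classic
          (fun S => \prod_(i <- S) 'x_i).

Lemma esym_locally_finite (k : nat) :
  locally_finite [set S : {fset nat} | #|` S|%fset = k]%classic
    (fun S => \prod_(i <- S) 'x_i).
Proof.
move=> m; apply: (@sub_finite_set _ _ [set [fset i in enum_mset m]%fset]%classic);
  last exact: finite_set1.
move=> S [_] /=; rewrite prod_fps_var; case: eqP => //= -> _.
by apply/fsetP => i; rewrite !inE (perm_mem (perm_eq_seq_mset _)).
Qed.

Definition esym_part (mu : seq nat) : fps := \prod_(k <- mu) esym k.

Definition is_partition (mu : seq nat) : bool :=
  sorted geq mu && (0%N \notin mu).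

Record simple_graph (n : nat) := SimpleGraph {
  edges : {set {set 'I_n}};
  edges_card2 : [forall e in edges, #|e| == 2%N]
}.

Definition proper_colouring n (G : simple_graph n) (k : {ffun 'I_n -> nat}) :=
  forall i j : 'I_n, [set i; j]%SET \in edges G -> k i != k j.

Definition chromatic_sf n (G : simple_graph n) : fps :=
  fps_sum [set k | proper_colouring G k]%classic
          (fun k : {ffun 'I_n -> nat} => \prod_(i < n) 'x_(k i)).

Lemma chromatic_sum_locally_finite n (G : simple_graph n) :
  locally_finite [set k | proper_colouring G k]%classic
    (fun k : {ffun 'I_n -> nat} => \prod_(i < n) 'x_(k i)).
Proof.
move=> m; pose s := enum_mset m.
apply: (@sub_finite_set _ _ ((fun g : {ffun 'I_n -> seq_sub s} =>
  [ffun i => val (g i)]) @` [set: {ffun 'I_n -> seq_sub s}])%classic); last first.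
  exact/finite_image/finite_finset.
move=> k [_] /=.
have -> : \prod_(i < n) 'x_(k i) = \prod_(j <- [seq k i | i <- enum 'I_n]) 'x_j.
  by rewrite big_map big_enum.
rewrite prod_fps_var; case: eqP => //= mE _.
have ks i : k i \in s.
  by rewrite /s mE (perm_mem (perm_eq_seq_mset _)) map_f// mem_enum.
by exists [ffun i => SeqSub (ks i)] => //; apply/ffunP => i; rewrite !ffunE.
Qed.

Fixpoint seqs_upto (T : Type) (X : seq T) (N : nat) : seq (seq T) :=
  if N is N'.+1 then [::] :: [seq x :: s | x <- X, s <- seqs_upto X N']
  else [:: [::]].

Lemma mem_seqs_upto (T : eqType) (X : seq T) (N : nat) (s : seq T) :
  (size s <= N)%N -> {subset s <= X} -> s \in seqs_upto X N.
Proof.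
elim: N s => [|N IHN] [|x s] //= sN sX; rewrite inE; apply/orP; right.
apply/allpairsP; exists (x, s); split=> //=; first by rewrite sX ?mem_head.
by apply: IHN => // y ys; rewrite sX// inE ys orbT.
Qed.

Section Trees.
Variable n : nat.
Implicit Types (E C : {set {set 'I_n}}).

Definition adj E : rel 'I_n := [rel x y | [set x; y]%SET \in E].

(* C is the edge set of a cycle all of whose edges lie in E. *)
Definition is_cycle E C :=
  exists c : seq 'I_n, [/\ (3 <= size c)%N, ucycle (adj E) c
    & C = [set [set x; next c x] | x in c]%SET].

Record subgraph := Subgraph { vset : {set 'I_n}; eset : {set {set 'I_n}} }.

Definition is_subgraph (G : simple_graph n) (T : subgraph) :=
  eset T \subset edges G /\ {in eset T, forall e : {set 'I_n}, e \subset vset T}.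

Definition is_tree (T : subgraph) :=
  [/\ vset T != finset.set0,
      {in vset T &, forall x y, connect (adj (eset T)) x y}
    & forall C, ~ is_cycle (eset T) C].

Definition strict_total_on E (lt : rel {set 'I_n}) :=
  [/\ {in E, irreflexive lt},
      {in E & &, transitive lt}
    & {in E &, forall e f, [|| e == f, lt e f | lt f e]}].

Definition is_max_edge (lt : rel {set 'I_n}) C (e : {set 'I_n}) :=
  e \in C /\ {in C, forall f, f != e -> lt f e}.

Definition is_NBC_tree (G : simple_graph n) (lt : rel {set 'I_n})
    (T : subgraph) :=
  [/\ is_subgraph G T, is_tree T
    & forall C e, is_cycle (edges G) C -> is_max_edge lt C e ->
        ~~ (C :\ e \subset eset T)%SET].

Definition is_composition (N : nat) (a : seq nat) : bool :=
  (0%N \notin a) && (sumn a == N).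

Record triple := Triple {
  ttree : subgraph;
  tcomp : seq nat;
  tmark : nat
}.

Definition is_tree_triple (G : simple_graph n) (lt : rel {set 'I_n})
    (t : triple) :=
  [/\ is_NBC_tree G lt (ttree t),
      is_composition #|vset (ttree t)| (tcomp t)
    & (1 <= tmark t <= head 0%N (tcomp t))%N].

Definition subgraph_code (T : subgraph) := (vset T, eset T).
Definition subgraph_decode p := Subgraph p.1 p.2.
Lemma subgraph_codeK : cancel subgraph_code subgraph_decode.
Proof. by case. Qed.
HB.instance Definition _ := Countable.copy subgraph (can_type subgraph_codeK).

Definition triple_code (t : triple) := (ttree t, tcomp t, tmark t).
Definition triple_decode p := Triple p.1.1 p.1.2 p.2.
Lemma triple_codeK : cancel triple_code triple_decode.
Proof. by case. Qed.
HB.instance Definition _ := Countable.copy triple (can_type triple_codeK).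

(* The value of the least element of V, or n if V is empty. *)
Definition min_vertex (V : {set 'I_n}) : nat := \big[minn/n]_(v in V) v.

Definition forest_triples (G : simple_graph n) (lt : rel {set 'I_n}) :
    set (seq triple) :=
  [set F | [/\ {in F, forall t, is_tree_triple G lt t},
               forall v, count (fun t => v \in vset (ttree t)) F = 1%N
             & sorted (fun t u => min_vertex (vset (ttree t))
                                  < min_vertex (vset (ttree u)))%N F]]%classic.

Definition ftype (F : seq triple) : seq nat :=
  sort geq (flatten [seq tcomp t | t <- F]).

Definition fsign (F : seq triple) : int :=
  (-1) ^+ (\sum_(t <- F) (size (tcomp t) - 1))%N.

Definition forest_triples_of_type (G : simple_graph n)
    (lt : rel {set 'I_n}) (mu : seq nat) : set (seq triple) :=
  [set F | forest_triples G lt F /\ ftype F = mu]%classic.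

Lemma forest_triples_finite (G : simple_graph n) (lt : rel {set 'I_n}) :
  finite_set (forest_triples G lt).
Proof.
pose Y := allpairs pair (allpairs (fun V E => Subgraph V E) (enum {set 'I_n})
  (enum {set {set 'I_n}})) (seqs_upto (iota 0 n.+1) n).
pose X := allpairs (fun Ta r => Triple Ta.1 Ta.2 r) Y (iota 0 n.+1).
apply: (@sub_finite_set _ _ [set` seqs_upto X n]%classic); last exact: finite_seq.
move=> F /= [tF cF _]; apply: mem_seqs_upto; last first.
  move=> [[V E] a r] /tF [[_ _ _] /= /andP[a0 /eqP aV] /andP[_ ra]].
  have Vn : (#|V| <= n)%N by rewrite -[leqRHS]card_ord max_card.
  have an x : x \in a -> (x < n.+1)%N.
    by move=> xa; rewrite ltnS (leq_trans _ Vn)// -aV (perm_sumn (perm_to_rem xa)) leq_addr.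
  apply/allpairsP; exists ((Subgraph V E, a), r); split=> //=.
    apply/allpairsP; exists (Subgraph V E, a); split=> //=.
      by apply/allpairsP; exists (V, E); rewrite !mem_enum.
    apply: mem_seqs_upto; last by move=> x xa; rewrite -/(iota 0 n.+1) mem_iota an.
    rewrite (leq_trans _ Vn)// -aV {aV an ra}.
    elim: a a0 => //= x a IHa; rewrite inE negb_or eq_sym -lt0n => /andP[x0 a0].
    by rewrite -add1n leq_add// IHa.
  rewrite -/(iota 0 n.+1) mem_iota /= ltnS (leq_trans ra)//.
  by case: a an {a0 aV ra} => //= x a an; rewrite -ltnS an ?mem_head.
rewrite -sum1_size -[leqRHS]card_ord -sum1_card.
rewrite [leqRHS](eq_bigr (fun v => \sum_(t <- F) (v \in vset (ttree t))))%N.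
  rewrite exchange_big /= big_seq [leqRHS]big_seq; apply: leq_sum => t /tF.
  case=> [[_ [V0 _ _] _] _ _]; rewrite [leqRHS](_ : _ = #|vset (ttree t)|).
    by rewrite card_gt0.
  by rewrite -sum1_card [RHS]big_mkcond; apply: eq_bigr => v _; case: (v \in _).
by move=> v _; rewrite -(cF v) -sumn_count sumnE big_map.
Qed.

Lemma forest_coef_finite_support (G : simple_graph n) (lt : rel {set 'I_n}) :
  finite_set [set mu | \sum_(F \in forest_triples_of_type G lt mu) fsign F
                         <> 0]%classic.
Proof.
apply: (@sub_finite_set _ _ (ftype @` forest_triples G lt)%classic).
  move=> mu /= cmu; apply: contra_notP cmu => Nmu.
  by apply: fsbig1 => F [FT Fmu]; case: Nmu; exists F.
exact/finite_image/forest_triples_finite.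
Qed.

End Trees.

(* Main.v *)
(* Inclusion-exclusion over the monochromatic edges gives                     *)
(*   X_G = \sum_(S \subset E) (-1)^|S| \prod_B p_|B|,                         *)
(* B ranging over the vertex sets of the components of ([n], S). Call an edge *)
(* e of G active in S if its ends are connected by edges of S smaller than e. *)
(* Toggling the least active edge changes neither the components nor the set  *)
(* of active edges up to e, so only the sets S without active edges survive;  *)
(* these are the NBC forests, for which (-1)^|S| = \prod_B (-1)^(|B|-1).      *)
(* Newton's identities turn (-1)^(k-1) p_k into the sum over the compositions *)
(* a of k of (-1)^(l(a)-1) a_1 e_a, and expanding the product over B gives    *)
(* the forest triples. Replacing e_1, e_2, ... by arbitrary ring elements,    *)
(* the signed sum over forest triples equals a sum over all S \subset E that  *)
(* does not mention the edge order; with independent variables instead of the *)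
(* e_k, each coefficient is seen to be independent of the order.              *)
Require Import Defs.
From HB Require Import structures.
From mathcomp Require Import all_boot all_order all_algebra.
From mathcomp Require Import finmap multiset.
From mathcomp Require Import boolp classical_sets functions cardinality fsbigop.

Set Implicit Arguments.
Unset Strict Implicit.
Unset Printing Implicit Defensive.

Import Order.TTheory GRing.Theory Num.Theory.

Local Open Scope ring_scope.

(** Both sides are compared with a signed sum over all edge subsets. For colourings,
    [sum_signed_subsets] detects the absence of monochromatic edges, and exchanging sums gives
    [fin_chromatic]. For forests, [sum_nbc] cancels the subsets with an active edge; by
    [active_cycle] and [cycle_active] the survivors are the sets without broken circuits. Such a set
    amounts to the list of trees of a forest triple ([choices_forest], [forest_union_pieces],
    [forest_union_nbc]), and summing over compositions and marks gives one factor [comp_sum] per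
    component. This yields [forest_sum], valid for any weights in place of the e_k; for elementary
    symmetric weights [newton] matches the factors of the two sums. These identities use finitely
    many variables. Each coefficient of a power series involves only finitely many, so [agree]
    carries them over to [chromatic_forest_expansion]. Deducing order independence from two
    expansions of X_G would require algebraic independence of the e_k; [forest_sum] with variables
    as weights gives it directly. *)

(** * Sign-reversing toggles on subsets *)

Section Sums.
Import boot.fintype boot.finset.
Variable R : comNzRingType.

Lemma setD1_notin (T : finType) (e : T) (S : {set T}) :
  e \notin S -> (S :\ e)%SET = S.
Proof. by move=> eS; apply/setDidPl; rewrite disjoint_sym disjoints1. Qed.

(** Subsets without [e] are paired with subsets containing it; the pairing preserves [P] and [f] and
    flips the parity of the cardinality. *)
Lemma sum_toggle0 (T : finType) (e : T) (P : pred {set T}) (f : {set T} -> R) :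
  (forall S, P (e |: S)%SET = P (S :\ e)%SET) ->
  (forall S, P S -> f (e |: S)%SET = f (S :\ e)%SET) ->
  \sum_(S | P S) (-1) ^+ #|S| * f S = 0.
Proof.
move=> Pe fe; rewrite (bigID (fun S : {set T} => e \in S)) /=.
rewrite (reindex_onto (fun S => e |: S)%SET (fun S => S :\ e)%SET) /=; last first.
  by move=> S /andP[_ eS]; rewrite setD1K.
rewrite (eq_bigl (fun S => P S && (e \notin S))); last first.
  move=> S; rewrite setU11 andbT; have [eS|eS] := boolP (e \in S).
    rewrite andbF; apply/negP => /andP[_ /eqP SE].
    by move: eS; rewrite -SE !inE eqxx.
  by rewrite setU1K// eqxx Pe andbT setD1_notin//= andbT.
rewrite -big_split big1// => S /andP[PS eS] /=.
by rewrite fe// cardsU1 eS exprS mulN1r setD1_notin// mulNr addNr.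
Qed.

Lemma sum_signed_subsets (T : finType) (A : {set T}) :
  \sum_(S : {set T} | S \subset A) (-1) ^+ #|S| = (A == set0)%:R :> R.
Proof.
have [->|/set0Pn[e eA]] := eqVneq A set0.
  by rewrite (big_pred1 set0) ?cards0 ?expr0// => S; rewrite subset0.
transitivity (\sum_(S : {set T} | S \subset A) (-1) ^+ #|S| * 1 : R).
  by apply: eq_bigr => S _; rewrite mulr1.
apply: (@sum_toggle0 T e (fun S => S \subset A) (fun=> 1)) => // S.
by rewrite subUset subDset (setUidPr _) sub1set eA.
Qed.
End Sums.

(** * Least and largest edges *)

Section Order.
Import boot.fintype boot.finset.
Variables (n : nat) (E : {set {set 'I_n}}) (lt : rel {set 'I_n}).
Hypothesis ltE : strict_total_on E lt.

(** Lets [strict_total_min] produce largest edges as well. *)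
Lemma strict_total_on_flip : strict_total_on E (fun e f => lt f e).
Proof.
case: ltE => irr tr tot; split => //.
- by move=> x y z xE yE zE /= xy yz; apply: tr yz xy.
- by move=> e f eE fE; rewrite eq_sym; apply: tot.
Qed.

Lemma strict_total_min (A : {set {set 'I_n}}) : A \subset E -> A != set0 ->
  exists2 e, e \in A & {in A, forall f, f != e -> lt e f}.
Proof.
case: ltE => irr tr tot /subsetP AE /set0Pn[e0 e0A].
(* An edge with the fewest edges of [A] below it is least: by transitivity a smaller one would have
   strictly fewer, since it is not below itself. *)
pose c e := #|[set f in A | lt f e]%SET|.
case: (arg_minnP (P := [in A]) c e0A) => e eA emin; exists e => // f fA fe.
case/or3P: (tot _ _ (AE _ fA) (AE _ eA)) => // [fe0|lfe]; first by rewrite fe0 in fe.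
have := emin _ fA; rewrite leqNgt => /negP[].
apply: proper_card; apply/properP; split.
  apply/subsetP => g; rewrite !inE => /andP[gA lgf]; rewrite gA /=.
  by apply: tr lgf lfe; rewrite ?AE.
by exists f; rewrite !inE ?fA ?lfe//= irr ?AE.
Qed.

Lemma strict_total_asym e f : e \in E -> f \in E -> lt e f -> ~~ lt f e.
Proof.
case: ltE => irr tr _ eE fE lef; apply/negP => lfe.
by have := tr _ _ _ fE eE eE lef lfe; rewrite irr.
Qed.
End Order.

(** * Components of an edge set *)

Section Components.
Import boot.fintype boot.finset.
Variable n : nat.
Implicit Types (S : {set {set 'I_n}}) (u v x y : 'I_n).

Lemma adj_sym S : symmetric (adj S).
Proof. by move=> x y; rewrite /adj /= setUC. Qed.

Lemma connect_adjC S : connect_sym (adj S).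
Proof. exact: sym_connect_sym (adj_sym S). Qed.

Lemma connect_adjS S S' x y : S \subset S' ->
  connect (adj S) x y -> connect (adj S') x y.
Proof.
move=> /subsetP sSS'; apply: connect_sub => u v uv.
by apply: connect1; apply: sSS'.
Qed.

Lemma set2_eq x y u v : [set x; y]%SET = [set u; v]%SET ->
  (x = u /\ y = v) \/ (x = v /\ y = u).
Proof.
move=> eqs; have : x \in [set u; v]%SET by rewrite -eqs set21.
have : y \in [set u; v]%SET by rewrite -eqs set22.
have : u \in [set x; y]%SET by rewrite eqs set21.
have : v \in [set x; y]%SET by rewrite eqs set22.
rewrite !inE => /orP[]/eqP ? /orP[]/eqP ? /orP[]/eqP ? /orP[]/eqP ?;
  by [left; split; congruence | right; split; congruence].
Qed.

Definition component S v : {set 'I_n} := [set u | connect (adj S) v u]%SET.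

(** Components are indexed by their least vertices, by which forest triples are also ordered. *)
Definition is_rep S v := [forall u, connect (adj S) v u ==> (v <= u)%N].

Definition rep S v : 'I_n := [arg min_(u < v | connect (adj S) v u) (u : nat)].

Lemma repP S v : connect (adj S) v (rep S v) /\ is_rep S (rep S v).
Proof.
rewrite /rep; case: arg_minnP => [|u vu umin]; first exact: connect0.
split => //; apply/forallP => w; apply/implyP => uw.
by apply: umin; apply: connect_trans uw.
Qed.

Lemma is_rep_uniq S u v : is_rep S u -> is_rep S v -> connect (adj S) u v -> u = v.
Proof.
move=> /forallP/(_ v)/implyP ru /forallP/(_ u)/implyP rv uv.
by apply/val_inj/eqP; rewrite eqn_leq ru// rv// connect_adjC.
Qed.

Lemma is_rep_connect S u v : is_rep S u && connect (adj S) u v = (rep S v == u).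
Proof.
have [vr rr] := repP S v; apply/andP/eqP => [[ru uv]|<-].
  by apply/esym/(is_rep_uniq ru rr)/(connect_trans uv).
by rewrite connect_adjC.
Qed.

Lemma rep_id S v : is_rep S v -> rep S v = v.
Proof. by move=> rv; apply/eqP; rewrite -is_rep_connect rv connect0. Qed.

Lemma rep_connect S u v : connect (adj S) u v = (rep S u == rep S v).
Proof.
have [ur rr] := repP S u; have [vr rr'] := repP S v; apply/idP/eqP => [uv|e].
  apply/eqP; rewrite -is_rep_connect rr' connect_adjC.
  exact: connect_trans uv vr.
by rewrite (connect_trans ur)// e connect_adjC.
Qed.

Lemma prod_by_rep (R : comNzRingType) S (f : 'I_n -> R) :
  \prod_u f u = \prod_(v | is_rep S v) \prod_(u in component S v) f u.
Proof.
rewrite (partition_big (rep S) (is_rep S)) /=; last by move=> u _; case: (repP S u).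
apply: eq_bigr => v rv; apply: eq_bigl => u.
by rewrite -is_rep_connect rv inE.
Qed.

Lemma sum_card_component S : (\sum_(v | is_rep S v) #|component S v| = n)%N.
Proof.
rewrite -[RHS]card_ord -sum1_card.
rewrite [RHS](partition_big (rep S) (is_rep S)) /=; last by move=> u _; case: (repP S u).
apply: eq_bigr => v rv; rewrite -sum1_card; apply: eq_bigl => u.
by rewrite -is_rep_connect rv inE.
Qed.

Lemma card_component_gt0 S v : (0 < #|component S v|)%N.
Proof. by apply/card_gt0P; exists v; rewrite inE connect0. Qed.

Section ExtraEdge.
Variables (S : {set {set 'I_n}}) (u v : 'I_n).
Let e : {set 'I_n} := [set u; v]%SET.

(** The right-hand side, as a property of [y], is closed under adjacency in the enlarged edge set
    and holds at [x]. *)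
Lemma connect_add_edge x y : connect (adj (e |: S)%SET) x y ->
  [|| connect (adj S) x y,
      connect (adj S) x u && connect (adj S) v y
    | connect (adj S) x v && connect (adj S) u y].
Proof.
pose a : pred 'I_n := fun y => [|| connect (adj S) x y,
  connect (adj S) x u && connect (adj S) v y
  | connect (adj S) x v && connect (adj S) u y].
have ca : closed (adj (e |: S)%SET) a.
  apply: intro_closed; first exact: connect_adjC.
  move=> y1 y2; rewrite /adj /= in_setU1 => /orP[/eqP/set2_eq uv|yS].
    rewrite /a !unfold_in; case: uv => [[-> ->]|[-> ->]].
      by case/or3P => [->|/andP[->]|/andP[->]]; rewrite ?connect0 ?orbT.
    by case/or3P => [->|/andP[->]|/andP[->]]; rewrite ?connect0 ?orbT.
  have yy : connect (adj S) y1 y2 by exact: connect1.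
  rewrite /a !unfold_in => /or3P[c|/andP[-> c]|/andP[-> c]];
    by rewrite (connect_trans c yy) ?orbT.
by move=> /(closed_connect ca); rewrite !unfold_in /a connect0 => <-.
Qed.

Lemma connect_add_edge_idem x y : connect (adj S) u v ->
  connect (adj (e |: S)%SET) x y = connect (adj S) x y.
Proof.
move=> uv; apply/idP/idP; last by apply: connect_adjS; exact: subsetUr.
case/connect_add_edge/or3P => // /andP[xu vy].
  by rewrite (connect_trans xu)// (connect_trans uv).
by rewrite (connect_trans xu)// (connect_trans _ vy)// connect_adjC.
Qed.

End ExtraEdge.

(** Merging two components destroys exactly one least vertex, the larger of the two. *)
Lemma card_reps_add_edge S u v : ~~ connect (adj S) u v ->
  #|[set x | is_rep S x]%SET| = #|[set x | is_rep ([set u; v] |: S)%SET x]%SET|.+1.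
Proof.
wlog lt : u v / (rep S u < rep S v)%N => [th Nuv|Nuv].
  have := Nuv; rewrite rep_connect -val_eqE neq_ltn => /orP[|] lt.
    exact: th lt Nuv.
  by rewrite setUC [[set u; v]%SET]setUC setUC; apply: th lt _; rewrite connect_adjC.
have [ur ru] := repP S u; have [vr rv] := repP S v.
rewrite (cardsD1 (rep S v)) inE rv add1n; congr _.+1.
apply: eq_card => x; rewrite !inE; apply/andP/idP => [[xv rx]|rx].
  apply/forallP => y; apply/implyP => /connect_add_edge/or3P[|/andP[xu vy]|/andP[xV uy]].
  - by move/forallP/(_ y)/implyP: rx.
  - have -> : x = rep S u by apply/esym/eqP; rewrite -is_rep_connect rx.
    apply/ltnW/(leq_trans lt); move/forallP/(_ y)/implyP: rv; apply.
    by rewrite (connect_trans _ vy)// connect_adjC.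
  - case/negP: xv; apply/eqP/esym/eqP; by rewrite -is_rep_connect rx.
split.
  apply/eqP => xE; move/forallP/(_ (rep S u))/implyP: rx; rewrite xE leqNgt lt.
  move=> h; suff: false by []. apply: h.
  have sS := subsetUr [set [set u; v]]%SET S.
  apply: (@connect_trans _ _ v); first by rewrite connect_adjC (connect_adjS sS vr).
  apply: (@connect_trans _ _ u); last exact: connect_adjS ur.
  by apply: connect1; rewrite adj_sym /adj /= in_setU1 eqxx.
apply/forallP => y; apply/implyP => xy; move/forallP/(_ y)/implyP: rx; apply.
exact: connect_adjS (subsetUr _ _) xy.
Qed.

End Components.

(** * Active edges and broken circuits *)

(** Nothing is required of steps leaving the last vertex; in [cycle_active] that is the vertex from
    which the cycle continues along [e]. *)
Lemma sub_path_belast (T : eqType) (r r' : rel T) x p :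
  (forall y z, y \in belast x p -> r y z -> r' y z) -> path r x p -> path r' x p.
Proof.
elim: p x => //= y p IHp x rr' /andP[xy yp]; rewrite rr' ?mem_head//=.
by apply: IHp yp => u v up; apply: rr'; rewrite inE up orbT.
Qed.

Section NoBrokenCircuit.
Import boot.fintype boot.finset.
Variables (n : nat) (E : {set {set 'I_n}}) (lt : rel {set 'I_n}).
Hypothesis E2 : {in E, forall e : {set 'I_n}, #|e| = 2}.
Hypothesis ltE : strict_total_on E lt.
Implicit Types (S : {set {set 'I_n}}) (e f : {set 'I_n}).

Definition below S e := [set f in S | lt f e]%SET.

(** For [S] inside [E] and [e] in [E]: [e] is the largest edge of a cycle whose other edges lie in
    [S]. Whether [e] itself is in [S] does not matter. *)
Definition active S e :=
  [exists u, exists v, (e == [set u; v]%SET) && connect (adj (below S e)) u v].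

Definition nbc S := (S \subset E) && [forall e in E, ~~ active S e].

Lemma activeP S e : reflect
  (exists u v, e = [set u; v]%SET /\ connect (adj (below S e)) u v) (active S e).
Proof.
apply: (iffP existsP) => [[u /existsP[v /andP[/eqP ? ?]]]|[u [v [? ?]]]].
  by exists u, v.
by exists u; apply/existsP; exists v; apply/andP; split=> //; apply/eqP.
Qed.

Definition least_active S e :=
  [&& e \in E, active S e & [forall f in E, lt f e ==> ~~ active S f]].

Lemma least_active_uniq S e f : least_active S e -> least_active S f -> e = f.
Proof.
move=> /and3P[eE eS /forall_inP emin] /and3P[fE fS /forall_inP fmin].
case: ltE => _ _ /(_ _ _ eE fE)/or3P[/eqP//|ef|fe].
  by move/implyP: (fmin _ eE) => /(_ ef); rewrite eS.
by move/implyP: (emin _ fE) => /(_ fe); rewrite fS.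
Qed.

Lemma least_active_exists S : ~~ [forall e in E, ~~ active S e] ->
  exists e, least_active S e.
Proof.
move=> /forall_inPn[e0 e0E /negPn e0S].
have [||e] := @strict_total_min n E lt ltE [set e in E | active S e]%SET.
- by apply/subsetP => e; rewrite inE => /andP[].
- by apply/set0Pn; exists e0; rewrite inE e0E.
rewrite inE => /andP[eE eS] emin; exists e; apply/and3P; split => //.
apply/forall_inP => f fE; apply/implyP => fe; apply/negP => fS.
have := emin f; rewrite inE fE fS => /(_ isT); case: eqVneq => [fe'|_ /(_ isT) ef].
  by case: ltE => irr _ _; move: fe; rewrite fe' irr.
by have := strict_total_asym ltE eE fE ef; rewrite fe.
Qed.

Lemma below_toggle S e f : ~~ lt e f -> below (e |: S)%SET f = below (S :\ e)%SET f.
Proof.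
move=> Nef; apply/setP => g; rewrite !inE; case: eqVneq => [->|//].
by rewrite (negPf Nef) andbF.
Qed.

(** Activity of [f] depends only on the edges below [f], and these do not include [e] unless [f] is
    above [e]. *)
Lemma least_active_toggle S e :
  least_active (e |: S)%SET e = least_active (S :\ e)%SET e.
Proof.
rewrite /least_active; have [eE|//] := boolP (e \in E).
have act f : ~~ lt e f -> active (e |: S)%SET f = active (S :\ e)%SET f.
  by move=> ef; rewrite /active below_toggle.
have irr : ~~ lt e e by case: ltE => irr _ _; rewrite irr.
rewrite act//=; congr (_ && _); apply: eq_forallb => f.
have [fE|//] := boolP (f \in E); have [fe|//] := boolP (lt f e).
by rewrite act//; apply: strict_total_asym fE eE fe.
Qed.

Lemma sum_nbc (R : comNzRingType) (f : {set {set 'I_n}} -> R) :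
  (forall S u v, connect (adj S) u v -> f ([set u; v] |: S)%SET = f S) ->
  \sum_(S : {set {set 'I_n}} | S \subset E) (-1) ^+ #|S| * f S
    = \sum_(S | nbc S) (-1) ^+ #|S| * f S.
Proof.
move=> fconn; rewrite (bigID (fun S => [forall e in E, ~~ active S e])) /=.
rewrite [X in _ + X](_ : _ = 0) ?addr0//.
(* The sets with an active edge are grouped by the least one, and each group is closed under
   toggling it. The default [set0] is never reached on these sets. *)
pose p S := odflt set0 [pick e | least_active S e].
have pP S : ~~ [forall e in E, ~~ active S e] -> least_active S (p S).
  move=> /least_active_exists[e eS]; rewrite /p; case: pickP => [//|/(_ e)].
  by rewrite eS.
rewrite (partition_big p predT)//= big1// => e _.
rewrite (eq_bigl (fun S => (S \subset E) && least_active S e)); last first.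
  move=> S; rewrite -andbA; congr (_ && _); apply/andP/idP => [[bS /eqP <-]|eS].
    exact: pP.
  have bS : ~~ [forall e in E, ~~ active S e].
    case/and3P: eS => eE eS _; apply/negP => /forall_inP/(_ _ eE).
    by rewrite eS.
  by split => //; apply/eqP; apply: least_active_uniq (pP _ bS) eS.
have [eE|eE] := boolP (e \in E); last first.
  by rewrite big_pred0// => S; rewrite /least_active (negPf eE) andbF.
apply: (@sum_toggle0 R _ e) => S.
  rewrite least_active_toggle; congr (_ && _).
  by rewrite subUset subDset (setUidPr _) sub1set eE.
move=> /andP[SE /and3P[_ /activeP[u [v [eE' uv]]] _]].
(* Since [e] is not below itself, the connection between its ends survives the removal of [e]. *)
suff : connect (adj (S :\ e)%SET) u v.
  move=> /fconn <-; rewrite -eE'; congr f; apply/setP => g; rewrite !inE.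
  by case: eqVneq.
apply: connect_adjS uv; apply/subsetP => g; rewrite !inE => /andP[gS ge].
rewrite gS andbT; apply: contraTneq ge => ->.
by case: ltE => irr _ _; rewrite irr.
Qed.

(** By induction on the number of edges. All other edges of [S] lie below its largest edge, so
    inactivity of that edge means that removing it separates its ends. *)
Lemma card_forest S : nbc S -> (#|S| + #|[set v | is_rep S v]%SET| = n)%N.
Proof.
have [k] := ubnP #|S|; elim: k S => // k IHk S Sk /andP[SE /forall_inP Sact].
have [->|S0] := eqVneq S set0.
  rewrite cards0 add0n -[RHS]card_ord; apply: eq_card => v; rewrite !inE.
  apply/forallP => u; apply/implyP; have : closed (adj set0) (pred1 v).
    by apply: intro_closed => [|x y]; [exact: connect_adjC | rewrite /adj/= inE].
  by move=> /closed_connect h /h; rewrite !inE eqxx => /esym/eqP ->.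
have [e eS emax] := strict_total_min (strict_total_on_flip ltE) SE S0.
have eE : e \in E by exact: (subsetP SE).
have /cards2P[u [v [uv eE']]] : #|e| == 2 by rewrite E2.
have below_e : below S e = (S :\ e)%SET.
  apply/setP => f; rewrite !inE andbC; have [fS|] := boolP (f \in S);
    last by rewrite !andbF.
  rewrite !andbT; case: eqVneq => [->|]; last exact: emax.
  by case: ltE => irr _ _; rewrite irr.
have Nuv : ~~ connect (adj (S :\ e)%SET) u v.
  apply: contra (Sact _ eE) => uv'; apply/activeP; exists u, v.
  by rewrite below_e.
have := card_reps_add_edge Nuv; rewrite -eE' setD1K// => repE.
have cS : #|S| = #|(S :\ e)%SET|.+1 by rewrite (cardsD1 e) eS.
rewrite cS addSnnS -repE; apply: IHk; first by rewrite cS in Sk.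
apply/andP; split; first exact: subset_trans (subD1set _ _) SE.
apply/forall_inP => f fE; apply: contra (Sact f fE) => /activeP[x [y [fxy xy]]].
apply/activeP; exists x, y; split=> //; apply: connect_adjS xy.
by apply/subsetP => g; rewrite !inE -andbA => /and3P[_ -> ->].
Qed.

(** A simple path of smaller edges between the ends of [e] is closed to a cycle by [e]. *)
Lemma active_cycle S e : S \subset E -> e \in E -> active S e ->
  exists C, [/\ is_cycle E C, is_max_edge lt C e & (C :\ e \subset S)%SET].
Proof.
move=> SE eE /activeP[u [v [euv /connectP[p0 pth0 lst0]]]].
case: (shortenP pth0) lst0 => p pth up _ lst {p0 pth0}.
have irr : lt e e = false by case: ltE => irr _ _; rewrite irr.
have bE w w' : adj (below S e) w w' -> adj E w w'.
  by rewrite /adj /= inE => /andP[/(subsetP SE)].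
(* The cycle needs three vertices: a path without steps would make [e] a singleton, and a path of
   one step would put [e] below itself. *)
have p2 : (2 <= size p)%N.
  case: p pth lst {up} => [|w [|//]] /= pth lst.
    by have := E2 eE; rewrite euv lst setUid cards1.
  by move: pth; rewrite -lst andbT /adj /= inE -euv irr andbF.
pose c := u :: p; exists [set [set x; next c x] | x in c]%SET.
pose r := [rel x y | adj (below S e) x y || ((x == v) && (y == u))].
have cr : cycle r c.
  rewrite /c /cycle rcons_path -lst /= !eqxx orbT andbT.
  by apply: sub_path pth => x y /= ->.
have mem f : f \in [set [set x; next c x] | x in c]%SET -> f = e \/ f \in below S e.
  move=> /imsetP[x xc ->]; have /orP[] := next_cycle cr xc; first by right.
  by move=> /andP[/eqP -> /eqP ->]; left; rewrite euv setUC.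
have eC : e \in [set [set x; next c x] | x in c]%SET.
  apply/imsetP; exists v; first by rewrite lst /c mem_last.
  rewrite euv setUC; congr [set _; _]%SET; apply/esym.
  by have := cycle_next up; rewrite /cycle rcons_path -lst => /andP[_ /eqP].
split.
- exists c; split=> //; apply/andP; split => //.
  apply: sub_cycle cr => x y /= /orP[/bE//|/andP[/eqP -> /eqP ->]].
  by rewrite /adj /= setUC -euv.
- by split=> // f /mem[->|]; rewrite ?eqxx// inE => /andP[].
- apply/subsetP => f; rewrite !inE => /andP[fe /mem[fe'|]].
    by rewrite fe' eqxx in fe.
  by rewrite inE => /andP[].
Qed.

(** Going round the cycle the long way joins the ends of [e] by smaller edges. *)
Lemma cycle_active S C e : is_cycle E C -> is_max_edge lt C e ->
  (C :\ e \subset S)%SET -> active S e.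
Proof.
move=> [c [c3 /andP[cc uc] CE]] [eC emax] sCS.
have := eC; rewrite {1}CE => /imsetP[x xc eE].
have [i c' rc] := rot_to xc.
have nextc : next c =1 next (x :: c') by move=> z; rewrite -rc next_rot.
have cmem : c =i x :: c' by move=> z; rewrite -rc mem_rot.
have uc' : uniq (x :: c') by rewrite -rc rot_uniq.
have : (3 <= size (x :: c'))%N by rewrite -rc size_rot.
case: c' => [|y [|z c'']] // in rc nextc cmem uc' * => _.
have ny : next c x = y by rewrite nextc /= eqxx.
apply/activeP; exists y, x; split; first by rewrite eE ny setUC.
have sub w : w \in y :: z :: c'' -> adj (below S e) w (next c w).
  move=> wc; have wx : w != x.
    by apply: contraTneq wc => ->; case/andP: uc'.
  (* The edge leaving [y] is [e] only if it returns to [x], which a cycle of length at least three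
     excludes. *)
  have we : [set w; next c w]%SET != e.
    apply/eqP; rewrite eE ny => /set2_eq[[wx' _]|[wy]]; first by rewrite wx' eqxx in wx.
    rewrite wy nextc /=; move: uc' => /= /and3P[]; rewrite !inE !negb_or.
    move=> /and3P[xy xz _] _ _; rewrite eq_sym (negPf xy) eqxx => zx.
    by rewrite zx eqxx in xz.
  have wC : [set w; next c w]%SET \in C.
    by rewrite CE; apply/imsetP; exists w; rewrite // cmem inE wc orbT.
  rewrite /adj/= inE emax// andbT; apply: (subsetP sCS).
  by rewrite !inE we.
have pth : path (frel (next [:: x, y, z & c''])) y (rcons (z :: c'') x).
  by have := cycle_next uc'; rewrite {1}/cycle rcons_cons [path _ _ _]/= => /andP[].
apply/connectP; exists (rcons (z :: c'') x).
  apply: (sub_path_belast _ pth) => w w'; rewrite belast_rcons => wc /eqP <-.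
  by rewrite -nextc; apply: sub.
by rewrite last_rcons.
Qed.
End NoBrokenCircuit.

(** * Forest triples over an NBC edge set *)

Section Compositions.

Definition compositions (k : nat) : seq (seq nat) :=
  undup [seq a <- seqs_upto (iota 0 k.+1) k | is_composition k a].

Lemma uniq_compositions k : uniq (compositions k).
Proof. exact: undup_uniq. Qed.

Lemma mem_compositions k a : (a \in compositions k) = is_composition k a.
Proof.
rewrite mem_undup mem_filter andb_idr// => /andP[a0 /eqP ak].
apply: mem_seqs_upto => [|x xa]; last first.
  rewrite -/(iota 0 k.+1) mem_iota /= ltnS -ak (perm_sumn (perm_to_rem xa)).
  exact: leq_addr.
elim: a k a0 ak => [//|x a IHa] k; rewrite inE negb_or eq_sym -lt0n.
by move=> /andP[x0 a0] <- /=; rewrite -add1n leq_add// IHa.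
Qed.

Variable R : comNzRingType.
Variable w : nat -> R.

Definition cweight (a : seq nat) : R := (-1) ^+ (size a - 1) * \prod_(k <- a) w k.

(** The total contribution of one tree on [k] vertices; the multiplicity counts the admissible
    marks. The empty composition has head 0 and contributes nothing. *)
Definition comp_sum (k : nat) : R := \sum_(a <- compositions k) cweight a *+ head 0%N a.

Variable n : nat.

Definition marked (T : subgraph n) : seq (triple n) :=
  [seq Triple T a r | a <- compositions #|vset T|, r <- iota 1 (head 0%N a)].

Lemma mem_marked T t : (t \in marked T) =
  [&& ttree t == T, is_composition #|vset T| (tcomp t)
    & (1 <= tmark t <= head 0%N (tcomp t))%N].
Proof.
apply/allpairsPdep/and3P => [[a [r [am rm ->]]]|[/eqP <- at_ rt]] /=.
  by rewrite eqxx -mem_compositions am; move: rm; rewrite mem_iota add1n ltnS.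
exists (tcomp t), (tmark t); rewrite mem_compositions mem_iota add1n ltnS.
by split=> //; case: (t).
Qed.

Lemma uniq_marked T : uniq (marked T).
Proof.
apply: allpairs_uniq_dep => [|a _|]; [exact: uniq_compositions | exact: iota_uniq |].
by move=> [a r] [a' r'] _ _ [/= -> ->].
Qed.

Lemma sum_marked T : \sum_(t <- marked T) cweight (tcomp t) = comp_sum #|vset T|.
Proof.
rewrite big_allpairs_dep; apply: eq_bigr => a _ /=.
by rewrite big_const_seq count_predT size_iota iter_addr_0.
Qed.

Fixpoint choices (Ts : seq (subgraph n)) : seq (seq (triple n)) :=
  if Ts is T :: Ts' then [seq t :: F | t <- marked T, F <- choices Ts']
  else [:: [::]].

Lemma uniq_choices Ts : uniq (choices Ts).
Proof.
elim: Ts => //= T Ts IHTs; apply: allpairs_uniq => //; first exact: uniq_marked.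
by move=> [t F] [t' F'] _ _ [-> ->].
Qed.

Lemma mem_choices Ts F : (F \in choices Ts) =
  ([seq ttree t | t <- F] == Ts) && all (fun t => t \in marked (ttree t)) F.
Proof.
elim: Ts F => [|T Ts IHTs] [|t F] //=.
  by apply/allpairsP => -[[t F] []].
rewrite eqseq_cons; apply/allpairsP/idP => [[[t' F'] [/= tT FTs [-> ->]]]|].
  move: FTs; rewrite IHTs => /andP[-> ->]; move: (tT).
  by rewrite mem_marked => /and3P[/eqP tT' _ _]; rewrite tT' eqxx tT.
move=> /andP[/andP[/eqP <- FTs] /andP[tt Fm]]; exists (t, F); split => //=.
by rewrite IHTs FTs.
Qed.

Lemma sum_choices Ts :
  \sum_(F <- choices Ts) \prod_(t <- F) cweight (tcomp t)
    = \prod_(T <- Ts) comp_sum #|vset T|.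
Proof.
elim: Ts => [|T Ts IHTs] /=; first by rewrite big_seq1 !big_nil.
rewrite big_allpairs_dep big_cons -sum_marked mulr_suml; apply: eq_bigr => t _.
by rewrite -IHTs mulr_sumr; apply: eq_bigr => F _; rewrite big_cons.
Qed.

Lemma prod_cweight (F : seq (triple n)) :
  \prod_(t <- F) cweight (tcomp t) = (\prod_(k <- ftype F) w k) *~ fsign F.
Proof.
rewrite /fsign -mulrzr rmorph_sign mulrC big_split /= -expr_sum; congr (_ * _).
rewrite (perm_big _ (permEl (perm_sort _ _))) big_flatten big_map.
by apply: eq_bigr => t _.
Qed.
End Compositions.

(** * NBC edge sets correspond to forests of NBC trees *)

Section Pieces.
Import boot.fintype boot.finset.

Lemma mem_bigcup_seq (I : Type) (T : finType) (r : seq I) (A : I -> {set T}) x :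
  (x \in \bigcup_(i <- r) A i)%SET = has (fun i => x \in A i) r.
Proof. by elim: r => [|i r IHr]; rewrite ?big_nil ?inE// big_cons inE IHr. Qed.

Variable n : nat.
Implicit Types (S : {set {set 'I_n}}).

Definition piece S v : subgraph n :=
  Subgraph (component S v) [set e in S | e \subset component S v]%SET.

(** Since [enum 'I_n] is increasing and representatives are least vertices, the list has the order
    required of a forest triple. *)
Definition pieces S : seq (subgraph n) := [seq piece S v | v <- enum 'I_n & is_rep S v].

Lemma component_eq S u v : u \in component S v -> component S u = component S v.
Proof.
rewrite inE => vu; apply/setP => x; rewrite !inE.
by rewrite !rep_connect in vu *; rewrite (eqP vu).
Qed.

Lemma mem_pieces S T : (T \in pieces S) = [exists v, T == piece S v].
Proof.
apply/mapP/existsP => [[v _ ->]|[v /eqP ->]]; first by exists v.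
have [vr rr] := repP S v; exists (rep S v); first by rewrite mem_filter rr mem_enum.
have vc : rep S v \in component S v by rewrite inE.
by rewrite /piece (component_eq vc).
Qed.

Lemma min_vertex_le (V : {set 'I_n}) v : v \in V -> (min_vertex V <= v)%N.
Proof.
move=> vV; rewrite /min_vertex; elim: (index_enum _) (mem_index_enum v) => //= u r IHr.
rewrite inE big_cons; case: eqVneq => [<- _|_ /= /IHr le]; first by rewrite vV geq_minl.
by case: ifP => // _; rewrite geq_min le orbT.
Qed.

Lemma min_vertex_component S v : is_rep S v -> min_vertex (component S v) = v.
Proof.
move=> /forallP rv; apply/eqP; rewrite eqn_leq; apply/andP; split.
  by apply: min_vertex_le; rewrite inE connect0.
rewrite /min_vertex; elim/big_ind: _ => [|x y|u].
- exact/ltnW/ltn_ord.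
- by rewrite leq_min => -> ->.
- by rewrite inE => vu; apply: (implyP (rv u)).
Qed.

Lemma pieces_sorted S :
  sorted (fun T U => min_vertex (vset T) < min_vertex (vset U))%N (pieces S).
Proof.
rewrite sorted_map; apply: (@sub_in_sorted _ (is_rep S) (fun u v => (u < v)%N)).
- by move=> u v ru rv /=; rewrite !min_vertex_component.
- exact: filter_all.
- apply: sorted_filter => [u v x|]; first exact: ltn_trans.
  have := iota_ltn_sorted 0 n; rewrite -val_enum_ord sorted_map.
  by [].
Qed.

Lemma count_pieces S v : count (fun T => v \in vset T) (pieces S) = 1%N.
Proof.
rewrite count_map count_filter (eq_count (a2 := pred1 (rep S v))); last first.
  by move=> u /=; rewrite inE andbC is_rep_connect eq_sym.
by rewrite count_uniq_mem ?enum_uniq// mem_enum.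
Qed.

Lemma eset_pieces (S : {set {set 'I_n}}) :
  {in S, forall e : {set 'I_n}, #|e| = 2} ->
  (\bigcup_(T <- pieces S) eset T)%SET = S.
Proof.
move=> S2; apply/setP => e; rewrite mem_bigcup_seq; apply/hasP/idP.
  by case=> T; rewrite mem_pieces => /existsP[v /eqP ->]; rewrite inE => /andP[].
move=> eS; have /cards2P[u [v [uv eE]]] : #|e| == 2 by rewrite S2.
exists (piece S u); first by rewrite mem_pieces; apply/existsP; exists u.
rewrite inE eS eE subUset !sub1set !inE connect0 connect1//.
by rewrite /adj /= -eE.
Qed.

Lemma connect_piece S v x y : x \in component S v -> connect (adj S) x y ->
  connect (adj (eset (piece S v))) x y.
Proof.
move=> + /connectP[p]; elim: p x => [|z p IHp] x xv /=; first by move=> _ ->.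
move=> /andP[xz pth] lst; have zv : z \in component S v.
  by move: xv; rewrite !inE => /connect_trans; apply; apply: connect1.
apply: (connect_trans (y := z)); last exact: IHp pth lst.
by apply: connect1; rewrite /adj /= inE subUset !sub1set xv zv !andbT.
Qed.

Section Forests.
Variables (G : simple_graph n) (lt : rel {set 'I_n}).
Hypothesis ltE : strict_total_on (edges G) lt.

Lemma edges2 : {in edges G, forall e : {set 'I_n}, #|e| = 2}.
Proof. by move=> e eE; apply/eqP; have /forall_inP := edges_card2 G; apply. Qed.

(** By [cycle_active] the set [S] contains no broken circuit. It contains no cycle either, because a
    cycle without its largest edge is a broken circuit. *)
Lemma piece_NBC S v : nbc (edges G) lt S -> is_NBC_tree G lt (piece S v).
Proof.
move=> /andP[SE /forall_inP Sact].
have sub : eset (piece S v) \subset S by apply/subsetP => e; rewrite inE => /andP[].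
have NC C e : is_cycle (edges G) C -> is_max_edge lt C e -> ~~ (C :\ e \subset S)%SET.
  move=> CC emax; have eE : e \in edges G.
    case: CC emax => c [_ /andP[cc _] CE] [+ _]; rewrite CE => /imsetP[x xc ->].
    exact: next_cycle cc xc.
  by apply: contra (Sact _ eE); exact: cycle_active CC emax.
split; last by move=> C e CC emax; apply: contra (NC C e CC emax) => /subset_trans; apply.
- split; first exact: subset_trans sub SE.
  by move=> e; rewrite inE => /andP[].
- split.
  + by apply/set0Pn; exists v; rewrite inE connect0.
  + move=> x y xv yv; apply: connect_piece => //; move: xv yv; rewrite !inE.
    by rewrite !rep_connect => /eqP <- /eqP <-.
  + move=> C [c [c3 /andP[cc uc] CE]].
    have CS : C \subset S.
      rewrite CE; apply/subsetP => e /imsetP[x xc ->]; apply: (subsetP sub).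
      exact: next_cycle cc xc.
    have CC : is_cycle (edges G) C.
      exists c; split=> //; apply/andP; split=> //; apply: sub_cycle cc => x y xy.
      exact/(subsetP SE)/(subsetP sub).
    have C0 : C != set0.
      case: c c3 CE {cc uc CC} => // x c _ ->; apply/set0Pn.
      by exists [set x; next (x :: c) x]%SET; apply/imsetP; exists x; rewrite ?mem_head.
    have [e eC emax] := strict_total_min (strict_total_on_flip ltE) (subset_trans CS SE) C0.
    have /negP[] := NC C e CC (conj eC emax).
    exact: subset_trans (subD1set _ _) CS.
Qed.

Lemma choices_forest S F : nbc (edges G) lt S -> F \in choices (pieces S) ->
  forest_triples G lt F.
Proof.
move=> Snbc; rewrite mem_choices => /andP[/eqP FS /allP Fm]; split.
- move=> t tF; have := Fm t tF; rewrite mem_marked eqxx /= => /andP[ct mt]; split=> //.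
  have : ttree t \in pieces S by rewrite -FS map_f.
  by rewrite mem_pieces => /existsP[v /eqP ->]; apply: piece_NBC.
- by move=> v; have := count_pieces S v; rewrite -FS count_map.
- by have := pieces_sorted S; rewrite -FS sorted_map.
Qed.

Definition forest_union (F : seq (triple n)) : {set {set 'I_n}} :=
  (\bigcup_(T <- [seq ttree t | t <- F]) eset T)%SET.

Lemma count_eq1_inj (T : eqType) (a : pred T) s x y :
  count a s = 1%N -> x \in s -> y \in s -> a x -> a y -> x = y.
Proof.
rewrite -size_filter => s1 xs ys ax ay.
have : x \in filter a s by rewrite mem_filter ax.
have : y \in filter a s by rewrite mem_filter ay.
by case: (filter a s) s1 => [|z [|]] //= _; rewrite !inE => /eqP -> /eqP ->.
Qed.

Section ForestOfTriples.
Variable F : seq (triple n).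
Hypothesis FT : forest_triples G lt F.
Let Ts := [seq ttree t | t <- F].
Let S := forest_union F.

Lemma tree_NBC T : T \in Ts -> is_NBC_tree G lt T.
Proof. by case: FT => tF _ _ /mapP[t /tF[? _ _] ->]. Qed.

Lemma tree_eq T U v : T \in Ts -> U \in Ts -> v \in vset T -> v \in vset U -> T = U.
Proof.
case: FT => _ cF _ TT UT vT vU.
by apply: (@count_eq1_inj _ (fun T => v \in vset T) Ts) => //; rewrite count_map cF.
Qed.

Lemma vertex_tree v : exists2 T, T \in Ts & v \in vset T.
Proof.
case: FT => _ /(_ v) cF _.
have : has (fun t => v \in vset (ttree t)) F by rewrite has_count cF.
by case/hasP => t tF vt; exists (ttree t) => //; apply: map_f.
Qed.

Lemma forest_union_sub : S \subset edges G.
Proof.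
apply/subsetP => e; rewrite mem_bigcup_seq => /hasP[T /tree_NBC[[TE _] _ _]].
exact: (subsetP TE).
Qed.

Lemma adj_forest_union T x y : T \in Ts -> x \in vset T -> adj S x y ->
  (adj (eset T) x y) && (y \in vset T).
Proof.
move=> TT xT; rewrite /adj /= mem_bigcup_seq => /hasP[U UT eU].
have [[_ /(_ _ eU)]] := tree_NBC UT; rewrite subUset !sub1set => /andP[xU yU] _ _.
by rewrite (tree_eq TT UT xT xU) eU.
Qed.

Lemma connect_forest_union T x y : T \in Ts -> x \in vset T ->
  connect (adj S) x y -> y \in vset T.
Proof.
move=> TT + /connectP[p]; elim: p x => [|z p IHp] x xT /=; first by move=> _ ->.
by move=> /andP[/(adj_forest_union TT xT)/andP[_ zT] pth]; apply: IHp.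
Qed.

(** The trees are vertex-disjoint, so no edge of the union leaves a tree, and each tree is a whole
    component of the union. *)
Lemma tree_piece T v : T \in Ts -> v \in vset T -> T = piece S v.
Proof.
move=> TT vT; have [[_ TV] [_ Tconn _] _] := tree_NBC TT.
have TS : eset T \subset S.
  by apply/subsetP => e eT; rewrite mem_bigcup_seq; apply/hasP; exists T.
have vE : vset T = component S v.
  apply/setP => u; rewrite inE; apply/idP/idP; last exact: connect_forest_union.
  by move=> uT; apply: connect_adjS TS _; apply: Tconn.
rewrite /piece -vE; case: T TT {vT Tconn vE} TV TS => V E TT /= TV TS; congr Subgraph.
apply/setP => e; rewrite inE; apply/idP/andP => [eE|[eS eV]].
  by rewrite TV//; split=> //; apply: (subsetP TS).
(* A vertex of [e] lies both in [T] and in the tree that supplied [e], so the two trees coincide. *)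
have /card_gt0P[x xe] : (0 < #|e|)%N by rewrite edges2// (subsetP forest_union_sub).
move: eS; rewrite mem_bigcup_seq => /hasP[U UT eU].
have [[_ /(_ _ eU)/subsetP/(_ _ xe) xU] _ _] := tree_NBC UT.
by have /(congr1 (@eset n))/= -> := tree_eq TT UT (subsetP eV _ xe) xU.
Qed.

Lemma forest_union_pieces : Ts = pieces S.
Proof.
pose r := [rel T U : subgraph n | min_vertex (vset T) < min_vertex (vset U)]%N.
apply: (@irr_sorted_eq _ r).
- by move=> ? ? ?; apply: ltn_trans.
- by move=> ?; apply: ltnn.
- by case: FT => _ _; rewrite /Ts sorted_map.
- exact: pieces_sorted.
move=> T; rewrite mem_pieces; apply/idP/existsP => [TT|[v /eqP ->]].
  have [_ [/set0Pn[v vT] _ _] _] := tree_NBC TT.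
  by exists v; apply/eqP/tree_piece.
by have [T' TT vT] := vertex_tree v; rewrite -(tree_piece TT vT).
Qed.

(** A path making an edge active cannot leave the tree where it starts. The edge would then be
    active in a single NBC tree, giving a broken circuit there. *)
Lemma forest_union_nbc : nbc (edges G) lt S.
Proof.
apply/andP; split; first exact: forest_union_sub.
apply/forall_inP => e eE; apply/negP => act.
have [u [v [euv /connectP[p pth lst]]]] := activeP _ _ _ act.
have [T TT uT] := vertex_tree u; have [[TE _] _ TNBC] := tree_NBC TT.
have [|C [CC emax /(elimN idP)[]]] := active_cycle (lt := lt) edges2 ltE TE eE.
  apply/activeP; exists u, v; split=> //; apply/connectP; exists p => //.
  elim: p u uT pth {lst euv} => //= x p IHp u uT /andP[]; rewrite {1}/adj/= inE.
  move=> /andP[/(adj_forest_union TT uT)/andP[uxT xT] uxe] pth.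
  by rewrite IHp// andbT /adj/= inE uxe andbT.
exact: TNBC.
Qed.

End ForestOfTriples.
End Forests.
End Pieces.

(** * The forest sum as a signed sum over edge sets *)

Section Master.
Import boot.fintype boot.finset.
Variables (n : nat) (G : simple_graph n) (R : comNzRingType) (w : nat -> R).

Section ForestSum.
Variable lt : rel {set 'I_n}.
Hypothesis ltE : strict_total_on (edges G) lt.

Lemma forest_sum_nbc :
  \sum_(F \in forest_triples G lt) (\prod_(k <- ftype F) w k) *~ fsign F
    = \sum_(S | nbc (edges G) lt S)
        \prod_(v | is_rep S v) comp_sum w #|component S v|.
Proof.
pose L := [seq F | X <- enum (nbc (edges G) lt), F <- choices (pieces X)].
have FL : forest_triples G lt = [set` L]%classic.
  apply/seteqP; split=> F /=.
    move=> FT; apply/allpairsPdep; exists (forest_union F), F.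
    rewrite mem_enum; split=> //; first exact: forest_union_nbc.
    rewrite mem_choices -(forest_union_pieces FT) eqxx; apply/allP => t tF.
    by have [/(_ t tF)[_ ct mt] _ _] := FT; rewrite mem_marked eqxx ct.
  move=> /allpairsPdep[S [F' [Snbc FS ->]]]; rewrite mem_enum in Snbc.
  exact: choices_forest FS.
have uL : uniq L.
  apply: allpairs_uniq_dep => [|S _|]; [exact: enum_uniq | exact: uniq_choices |].
  (* The edge set is recovered as the union of the trees, so no forest triple is listed twice. *)
  have UE U F : U \in enum (nbc (edges G) lt) -> F \in choices (pieces U) ->
      forest_union F = U.
    rewrite mem_enum mem_choices => /andP[SE _] /andP[/eqP FS _].
    rewrite /forest_union FS eset_pieces// => e /(subsetP SE); exact: edges2.
  move=> p q /allpairsPdep[S [F [SE FS ->]]] /allpairsPdep[S' [F' [SE' FS' ->]]] /= FF.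
  by move: FS' SE'; rewrite -FF => FS' SE'; rewrite -(UE S F)// -(UE S' F).
rewrite FL -fsbig_seq// big_allpairs_dep big_enum; apply: eq_bigr => S _ /=.
under eq_bigr do rewrite -prod_cweight.
by rewrite sum_choices /pieces big_map big_filter big_enum_cond.
Qed.

(** The right-hand side does not mention [lt]; order independence rests on this. *)
Lemma forest_sum :
  \sum_(F \in forest_triples G lt) (\prod_(k <- ftype F) w k) *~ fsign F
    = \sum_(S : {set {set 'I_n}} | S \subset edges G) (-1) ^+ #|S| *
        \prod_(v | is_rep S v)
          ((-1) ^+ (#|component S v| - 1) * comp_sum w #|component S v|).
Proof.
rewrite (sum_nbc ltE); last first.
  move=> S u v uv; have cE x : component ([set u; v] |: S)%SET x = component S x.
    by apply/setP => y; rewrite !inE connect_add_edge_idem.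
  apply: eq_big => x; last by rewrite cE.
  by apply: eq_forallb => y; rewrite connect_add_edge_idem.
rewrite forest_sum_nbc; apply: eq_bigr => S Snbc.
(* For an NBC set the sign of [S] and the signs of its components cancel. *)
suff e : (\sum_(v | is_rep S v) (#|component S v| - 1) = #|S|)%N.
  by rewrite big_split -expr_sum e mulrA -expr2 sqrr_sign mul1r.
apply/eqP; rewrite -(eqn_add2r #|[set v | is_rep S v]%SET|).
rewrite (card_forest (@edges2 _ G) ltE Snbc) -[X in _ == X](sum_card_component S).
rewrite -sum1_card [X in (_ + X == _)%N](eq_bigl (is_rep S)); last first.
  by move=> v; rewrite inE.
rewrite -big_split; apply/eqP/eq_bigr => v _.
by rewrite /= subnK ?card_component_gt0.
Qed.
End ForestSum.
End Master.

(** * Newton's identities *)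

Section Newton.
Import boot.fintype boot.finset.
Variables (R : comNzRingType) (w : nat -> R).

(** The last part is split off because the first one carries the mark. *)
Lemma compositions_rcons k : (0 < k)%N ->
  perm_eq (compositions k) [seq rcons a (k - i)%N | i <- iota 0 k, a <- compositions i].
Proof.
move=> k0; apply: uniq_perm; first exact: uniq_compositions.
  apply: allpairs_uniq_dep => [|i _|]; [exact: iota_uniq | exact: uniq_compositions |].
  move=> p q /allpairsPdep[i [a [_ + ->]]] /allpairsPdep[j [b [_ + ->]]] /=.
  rewrite !mem_compositions => /andP[_ /eqP <-] /andP[_ /eqP <-] /rcons_inj[-> _].
  by [].
move=> a; rewrite mem_compositions; apply/idP/allpairsPdep => [|[i [b [+ + ->]]]].
  case/lastP: a => [|a x]; first by rewrite /is_composition /= eq_sym (gtn_eqF k0).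
  rewrite /is_composition mem_rcons inE negb_or eq_sym -lt0n sumn_rcons.
  move=> /andP[/andP[x0 a0] /eqP <-]; exists (sumn a), a.
  rewrite mem_iota mem_compositions /= add0n -{1}[sumn a]addn0 ltn_add2l x0.
  by rewrite /is_composition a0 eqxx addKn.
rewrite mem_iota mem_compositions /= add0n => ik /andP[b0 /eqP bi].
rewrite /is_composition mem_rcons inE negb_or b0 sumn_rcons bi subnKC ?eqxx 1?ltnW//.
by rewrite !andbT eq_sym -lt0n subn_gt0.
Qed.

Lemma compositions0 : compositions 0 = [:: [::]].
Proof. by []. Qed.

Lemma comp_sum_rec k : (0 < k)%N ->
  comp_sum w k = w k *+ k - \sum_(1 <= i < k) w (k - i)%N * comp_sum w i.
Proof.
move=> k0; rewrite /comp_sum (perm_big _ (compositions_rcons k0)) big_allpairs_dep.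
rewrite (_ : iota 0 k = index_iota 0 k); last by rewrite /index_iota subn0.
(* The term [i = 0] is the one-part composition, with head [k]. For [i > 0] the new part keeps the
   head and flips the sign. *)
rewrite big_ltn//.
rewrite compositions0 big_seq1 /= /cweight /= subn0 subnn expr0 mul1r big_seq1; congr (_ + _).
rewrite -sumrN; apply: eq_big_nat => i /andP[i0 ik].
rewrite mulr_sumr -sumrN; apply: eq_big_seq => a.
rewrite mem_compositions; case: a => [|x a].
  by move=> /andP[_ /eqP i0']; rewrite -i0' in i0.
move=> _ /=; rewrite size_rcons !subn1 /= exprS -rcons_cons big_rcons /=.
rewrite mulrnAr -mulNrn; congr (_ *+ _); rewrite mulN1r !mulNr mulrA.
by rewrite mulrC.
Qed.

Variables (I : finType) (x : I -> R).

Definition fin_esym k : R := \sum_(S : {set I} | #|S| == k) \prod_(i in S) x i.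

Definition fin_psum k : R := \sum_i x i ^+ k.

(** For [i > 1] this is the monomial symmetric polynomial of the hook [(i, 1^j)]; for [i = 1] every
    monomial is counted [j + 1] times. *)
Definition hook i j : R :=
  \sum_a \sum_(S : {set I} | (#|S| == j) && (a \notin S)) x a ^+ i * \prod_(c in S) x c.

Lemma sum_in_hook i j :
  \sum_a \sum_(S : {set I} | (#|S| == j.+1) && (a \in S)) x a ^+ i * \prod_(c in S) x c
  = hook i.+1 j.
Proof.
apply: eq_bigr => a _.
rewrite (reindex_onto (fun S => a |: S)%SET (fun S => S :\ a)%SET) /=; last first.
  by move=> S /andP[_ aS]; rewrite setD1K.
apply: eq_big => [S|S /andP[/andP[cS _] /eqP aS]].
  rewrite setU11 andbT; have [aS|aS] := boolP (a \in S).
    rewrite andbF; apply/negP => /andP[_ /eqP SE].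
    by move: aS; rewrite -SE !inE eqxx.
  by rewrite setU1K// eqxx cardsU1 aS !andbT.
have {}aS : a \notin S by rewrite -aS !inE eqxx.
by rewrite big_setU1//= mulrA exprSr.
Qed.

(* Split by whether the variable of the power sum occurs in the product taken *)
(* from the elementary symmetric polynomial.                                  *)
Lemma psum_esym i j : fin_psum i * fin_esym j.+1 = hook i j.+1 + hook i.+1 j.
Proof.
rewrite -sum_in_hook -big_split mulr_suml; apply: eq_bigr => a _ /=.
rewrite mulr_sumr (bigID (fun S : {set I} => a \in S)) addrC /=; congr (_ + _).
Qed.

Lemma hook_i0 i : hook i 0 = fin_psum i.
Proof.
apply: eq_bigr => a _; rewrite (big_pred1 set0) ?big_set0 ?mulr1// => S /=.
by rewrite cards_eq0 andb_idr// => /eqP ->; rewrite inE.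
Qed.

Lemma hook_1j j : hook 1 j = fin_esym j.+1 *+ j.+1.
Proof.
rewrite -sum_in_hook (exchange_big_dep (fun S : {set I} => #|S| == j.+1)) /=; last first.
  by move=> a S _ /andP[].
rewrite -sumrMnl; apply: eq_bigr => S Sj.
rewrite (eq_bigl [in S]); last by move=> a; rewrite Sj.
under eq_bigr do rewrite expr0 mul1r.
by rewrite sumr_const (eqP Sj).
Qed.

End Newton.

Lemma newton (R : comNzRingType) (I : finType) (x : I -> R) k : (0 < k)%N ->
  (-1) ^+ (k - 1) * comp_sum (fin_esym x) k = fin_psum x k.
Proof.
move=> k0; suff -> : comp_sum (fin_esym x) k = (-1) ^+ (k - 1) * fin_psum x k.
  by rewrite mulrA -expr2 sqrr_sign mul1r.
elim/ltn_ind: k k0 => k IHk k0; rewrite comp_sum_rec//.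
(* By induction and [psum_esym] the summands are [U i.+1 - U i]. The leading term [k] times e_k
   equals [- U 1], so only [- U k] remains, and [hook x k 0] is the power sum. *)
pose U i := (-1) ^+ i * hook x i (k - i)%N.
case: k k0 IHk @U => // k _ IHk U; rewrite -hook_1j subn1 /=.
have -> : \sum_(1 <= i < k.+1) fin_esym x (k.+1 - i)%N * comp_sum (fin_esym x) i
    = \sum_(1 <= i < k.+1) (U i.+1 - U i).
  apply: eq_big_nat => i /andP[i0 ik].
  rewrite IHk// mulrCA [fin_esym _ _ * _]mulrC /U subSS subSn// psum_esym.
  case: i i0 {ik} => // i _; rewrite subn1 /= !exprS !mulN1r.
  by rewrite !mulNr !opprK mulrDr addrC.
rewrite telescope_sumr// /U subnn hook_i0 subn1/= expr1 exprS !mulN1r !mulNr.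
by rewrite opprD !opprK addrCA subrr addr0.
Qed.

(** * The chromatic sum in finitely many variables *)

Section FiniteChromatic.
Import boot.fintype boot.finset.
Variables (n : nat) (G : simple_graph n) (R : comNzRingType).

Definition fin_proper N (c : {ffun 'I_n -> 'I_N}) :=
  [forall i, forall j, ([set i; j]%SET \in edges G) ==> (c i != c j)].

Variables (N : nat) (x : 'I_N.+1 -> R).
Implicit Types (S : {set {set 'I_n}}) (c : {ffun 'I_n -> 'I_N.+1}).

Definition mono c := [set e in edges G | [forall i in e, forall j in e, c i == c j]]%SET.

Lemma fin_properE c : fin_proper c = (mono c == set0).
Proof.
apply/idP/eqP => [/forallP cp|m0].
  apply/setP => e; rewrite !inE; apply/negP => /andP[eE /forall_inP em].
  have /cards2P[i [j [ij eij]]] : #|e| == 2 by rewrite (@edges2 _ G).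
  have /forallP/(_ j) := cp i; rewrite -eij eE /=; case/negP.
  by apply: (forall_inP (em i _)); rewrite eij !inE eqxx ?orbT.
apply/forallP => i; apply/forallP => j; apply/implyP => eE; apply/negP => cij.
have : [set i; j]%SET \in mono c.
  rewrite inE eE; apply/forall_inP => k; rewrite !inE => ki.
  apply/forall_inP => l; rewrite !inE => lj.
  by case/orP: ki => /eqP ->; case/orP: lj => /eqP ->; rewrite // eq_sym.
by rewrite m0 inE.
Qed.

Lemma sub_monoP S c : S \subset edges G ->
  (S \subset mono c) = [forall v, c v == c (rep S v)].
Proof.
move=> SE; apply/idP/forallP => [/subsetP Sm v|crep].
  have [/connectP[p pth ->] _] := repP S v.
  elim: p v pth => //= u p IHp v /andP[vu pth]; rewrite -(eqP (IHp u pth)).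
  have := Sm _ vu; rewrite inE => /andP[_ /forall_inP/(_ v)].
  by rewrite set21 => /(_ isT)/forall_inP; apply; rewrite set22.
apply/subsetP => e eS; rewrite inE (subsetP SE)//=.
have /cards2P[i [j [ij eij]]] : #|e| == 2 by rewrite (@edges2 _ G)// (subsetP SE).
have cij : c i == c j.
  rewrite (eqP (crep i)) (eqP (crep j)).
  suff /eqP -> : rep S i == rep S j by [].
  by rewrite -rep_connect connect1// /adj /= -eij.
rewrite eij; apply/forall_inP => k; rewrite !inE => ki.
apply/forall_inP => l; rewrite !inE => lj.
by case/orP: ki => /eqP ->; case/orP: lj => /eqP ->; rewrite // eq_sym.
Qed.

Lemma sum_component_colourings S :
  \sum_(c : {ffun 'I_n -> 'I_N.+1} | [forall v, c v == c (rep S v)]) \prod_v x (c v)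
    = \prod_(v | is_rep S v) fin_psum x #|component S v|.
Proof.
(* A colouring constant on components amounts to a choice of colours at the representatives. Such a
   choice is encoded as a function equal to [ord0] elsewhere, which requires a nonempty set of
   colours. *)
rewrite (big_distr_big_dep ord0) /=.
rewrite (reindex_onto (fun f : {ffun 'I_n -> 'I_N.+1} => [ffun v => f (rep S v)])
   (fun c : {ffun 'I_n -> 'I_N.+1} =>
      [ffun v => if is_rep S v then c v else ord0])) /=; last first.
  move=> c /forallP crep; apply/ffunP => v; rewrite !ffunE.
  by have [_ ->] := repP S v; rewrite -(eqP (crep v)).
apply: eq_big => [f|f _].
  apply/andP/pfamilyP => [[_ /eqP <-]|[/subsetP fsupp _]].
    split=> //; apply/subsetP => v; rewrite !inE ffunE.
    by case: ifP => //; rewrite eqxx.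
  split.
    by apply/forallP => v; rewrite !ffunE (rep_id (proj2 (repP S v))).
  apply/eqP/ffunP => v; rewrite !ffunE; case: ifP => [rv|/negP rv].
    by rewrite rep_id.
  by have := fsupp v; rewrite !inE => fv; apply/esym/eqP/negPn/negP => /fv.
rewrite (prod_by_rep S); apply: eq_bigr => v rv.
rewrite -prodr_const; apply: eq_bigr => u; rewrite inE => vu.
by rewrite ffunE; congr (x (f _)); apply/eqP; rewrite -is_rep_connect rv.
Qed.

Lemma fin_chromatic : \sum_(c | fin_proper c) \prod_v x (c v)
  = \sum_(S : {set {set 'I_n}} | S \subset edges G) (-1) ^+ #|S| *
      \prod_(v | is_rep S v) fin_psum x #|component S v|.
Proof.
rewrite big_mkcond /=.
transitivity (\sum_c \sum_(S : {set {set 'I_n}} | S \subset mono c)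
    (-1) ^+ #|S| * \prod_v x (c v)).
  apply: eq_bigr => c _; rewrite -mulr_suml sum_signed_subsets fin_properE.
  by case: eqP; rewrite ?mul1r ?mul0r.
rewrite (exchange_big_dep (fun S : {set {set 'I_n}} => S \subset edges G)) /=; last first.
  move=> c S _ /subset_trans; apply; apply/subsetP => e.
  by rewrite inE => /andP[].
apply: eq_bigr => S SE; rewrite -mulr_sumr -sum_component_colourings.
by congr (_ * _); apply: eq_bigl => c; rewrite sub_monoP.
Qed.

Lemma fin_chromatic_forest lt : strict_total_on (edges G) lt ->
  \sum_(c | fin_proper c) \prod_v x (c v)
    = \sum_(F \in forest_triples G lt) (\prod_(k <- ftype F) fin_esym x k) *~ fsign F.
Proof.
move=> ltE; rewrite fin_chromatic forest_sum//; apply: eq_bigr => S _.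
by congr (_ * _); apply: eq_bigr => v _; rewrite newton ?card_component_gt0.
Qed.

End FiniteChromatic.

(** * Truncation of power series to finitely many variables *)

Section Truncation.
Variable N : nat.
Implicit Types f g : fps.

(** Equality after setting to zero the variables of index at least [N]. *)
Definition agree f g := forall m : monomial, (forall i, i \in m -> (i < N)%N) -> f m = g m.

Lemma agreeD f f' g g' : agree f f' -> agree g g' -> agree (f + g) (f' + g').
Proof. by move=> ff gg m mN; rewrite [LHS]/GRing.add /= ff// gg. Qed.

Lemma agreeN f f' : agree f f' -> agree (- f) (- f').
Proof. by move=> ff m mN; rewrite [LHS]/GRing.opp /= ff. Qed.

(** The factors of a monomial involve no further variables. *)
Lemma agreeM f f' g g' : agree f f' -> agree g g' -> agree (f * g) (f' * g').
Proof.
move=> ff gg m mN; rewrite [LHS]fps_mulE [RHS]fps_mulE; apply: eq_big_seq => -[a b] /=.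
rewrite mem_monomial_splits /= => /eqP abm.
by rewrite ff ?gg// => i ia; apply: mN; rewrite -abm in_msetD ia ?orbT.
Qed.

Lemma agree_prod (I : Type) (r : seq I) (F F' : I -> fps) :
  (forall i, agree (F i) (F' i)) -> agree (\prod_(i <- r) F i) (\prod_(i <- r) F' i).
Proof. by move=> FF; elim/big_rec2: _ => // i f f' _; apply: agreeM. Qed.

Lemma agree_sum (I : Type) (r : seq I) (F F' : I -> fps) :
  (forall i, agree (F i) (F' i)) -> agree (\sum_(i <- r) F i) (\sum_(i <- r) F' i).
Proof. by move=> FF; elim/big_rec2: _ => // i f f' _; apply: agreeD. Qed.

Lemma agree_sign f f' k : agree f f' -> agree (f *~ (-1) ^+ k) (f' *~ (-1) ^+ k).
Proof.
move=> ff; rewrite -signr_odd; case: (odd k); rewrite ?expr1 ?expr0 ?mulrNz ?mulr1z//.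
exact: agreeN.
Qed.

(** At a fixed [m], a finite family suffices if it covers the indices with a nonzero coefficient
    there. *)
Lemma fps_sum_fin (I : choiceType) (J : finType) (A : set I) (P : pred J)
    (h : J -> I) (f : I -> fps) (m : monomial) :
  injective h -> (forall j, P j -> A (h j)) ->
  (forall i, A i -> f i m <> 0 -> exists2 j, P j & h j = i) ->
  fps_sum A f m = \sum_(j | P j) f (h j) m.
Proof.
move=> hI PA Ah; pose r := [seq h j | j <- enum P].
have ur : uniq r by rewrite map_inj_uniq ?enum_uniq.
transitivity (\sum_(i <- r) f i m); last by rewrite big_map big_enum.
rewrite fsbig_seq//; apply/esym/fsbig_widen => i /=.
  by move=> /mapP[j]; rewrite mem_enum => /PA Aj ->.
move=> [Ai ir]; apply: contrapT => /(Ah _ Ai)[j Pj ji].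
by apply/ir/mapP; exists j; rewrite ?mem_enum.
Qed.

Lemma sum_fpsE (I : Type) (r : seq I) (P : pred I) (F : I -> fps) (m : monomial) :
  (\sum_(i <- r | P i) F i) m = \sum_(i <- r | P i) F i m.
Proof. exact: (big_morph (fun f : fps => f m)). Qed.

Lemma esym_agree k : agree (Defs.esym k) (fin_esym (fun i : 'I_N => 'x_i) k).
Proof.
move=> m mN; rewrite /fin_esym sum_fpsE.
pose h (S : {set 'I_N}) : {fset nat} := [fset i in [seq val i | i <- enum S]]%fset.
have hS S : perm_eq (h S) [seq val i | i <- enum S].
  apply: uniq_perm => [||i]; [exact: fset_uniq | | by rewrite inE].
  by rewrite map_inj_uniq ?enum_uniq//; exact: val_inj.
have prodE (S : {set 'I_N}) : \prod_(i in S) 'x_(val i) = \prod_(i <- h S) 'x_i :> fps.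
  by rewrite (perm_big _ (hS S)) big_map big_enum.
rewrite /Defs.esym (@fps_sum_fin _ _ _ (fun S : {set 'I_N} => #|S| == k) h); last 3 first.
- move=> S S' hSS'; apply/finset.setP => i.
  have memh (U : {set 'I_N}) : (i \in U) = (val i \in h U).
    by rewrite (perm_mem (hS U)) (mem_map val_inj) mem_enum.
  by rewrite !memh hSS'.
- by move=> S /eqP <- /=; rewrite (perm_size (hS S)) size_map cardE.
- move=> U /= Uk; rewrite prod_fps_var; case: eqP => //= mE _.
  have UN i : i \in U -> (i < N)%N.
    by move=> iU; apply: mN; rewrite mE (perm_mem (perm_eq_seq_mset _)).
  have hU : h [set i : 'I_N | val i \in U]%SET = U.
    apply/fsetP => i; rewrite (perm_mem (hS _)); apply/mapP/idP => [[j]|iU].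
      by rewrite mem_enum inE => jU ->.
    by exists (Ordinal (UN i iU)); rewrite // mem_enum inE.
  exists [set i : 'I_N | val i \in U]%SET => //.
  by rewrite -Uk -{2}hU (perm_size (hS _)) size_map cardE.
by apply: eq_bigr => S _; rewrite prodE.
Qed.

Lemma chromatic_agree n (G : simple_graph n) : agree (chromatic_sf G)
  (\sum_(c : {ffun 'I_n -> 'I_N} | fin_proper G c) \prod_v 'x_(val (c v))).
Proof.
move=> m mN; rewrite sum_fpsE /chromatic_sf.
pose h (c : {ffun 'I_n -> 'I_N}) := [ffun v => val (c v)].
rewrite (@fps_sum_fin _ _ _ (fun c => fin_proper G c) h).
- apply: eq_bigr => c _; apply: (congr1 (fun f : fps => f m)).
  by apply: eq_bigr => v _; rewrite ffunE.
- move=> c c' /ffunP hc; apply/ffunP => v; apply: val_inj.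
  by have := hc v; rewrite !ffunE.
- move=> c /forallP cp i j eE; have /forallP/(_ j)/implyP/(_ eE) := cp i.
  by rewrite !ffunE.
- move=> c cp; rewrite (_ : \prod_(i < n) 'x_(c i)
    = \prod_(i <- [seq c i | i <- enum 'I_n]) 'x_i); last first.
    by rewrite big_map big_enum.
  rewrite prod_fps_var; case: eqP => //= mE _.
  have cN v : (c v < N)%N.
    by apply: mN; rewrite mE (perm_mem (perm_eq_seq_mset _)) map_f ?mem_enum.
  exists [ffun v => Ordinal (cN v)]; last by apply/ffunP => v; rewrite !ffunE.
  apply/forallP => i; apply/forallP => j; apply/implyP => /cp.
  by rewrite !ffunE.
Qed.
End Truncation.

(** * The expansion, grouping by type, and the coefficients *)

Lemma chromatic_forest_expansion n (G : simple_graph n) (lt : rel {set 'I_n}) :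
  strict_total_on (edges G) lt ->
  chromatic_sf G = \sum_(F \in forest_triples G lt) esym_part (ftype F) *~ fsign F.
Proof.
(* [N] bounds the indices occurring in [m], so the variables of index at most [N] determine this
   coefficient. *)
move=> ltE; apply/funext => m; pose N := (\max_(i <- enum_mset m) i)%N.
have mN i : i \in m -> (i < N.+1)%N.
  by move=> im; rewrite ltnS /N (big_rem i)//= leq_maxl.
rewrite (chromatic_agree G mN) (fin_chromatic_forest (fun i : 'I_N.+1 => 'x_i) ltE).
rewrite !fsbig_finite; [|exact: forest_triples_finite..].
symmetry; apply: (@agree_sum N.+1 _ _ _ _ _ m mN) => F.
by apply: agree_sign; apply: agree_prod => k; apply: esym_agree.
Qed.

Lemma ftype_partition n (G : simple_graph n) (lt : rel {set 'I_n}) F :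
  forest_triples G lt F -> is_partition (ftype F).
Proof.
case=> tF _ _; apply/andP; split.
  by apply: sort_sorted => i j; exact: leq_total.
rewrite mem_sort; apply/negP => /flattenP[a /mapP[t /tF[_ /andP[a0 _] _] ->]].
exact/negP.
Qed.

Lemma forest_coefE n (G : simple_graph n) (lt : rel {set 'I_n}) mu :
  \sum_(F \in forest_triples_of_type G lt mu) fsign F
    = \sum_(F <- fset_set (forest_triples G lt) | ftype F == mu) fsign F.
Proof.
rewrite -[RHS]big_filter [RHS]fsbig_seq ?filter_uniq ?fset_uniq//.
have fin := forest_triples_finite G lt.
apply: eq_fsbigl; apply/seteqP; split=> F /=; rewrite mem_filter.
  by move=> [FT ->]; rewrite eqxx in_fset_set// inE.
by move=> /andP[/eqP Fmu]; rewrite in_fset_set// inE.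
Qed.

Lemma forest_sum_by_type (R : comNzRingType) (w : seq nat -> R) n
    (G : simple_graph n) (lt : rel {set 'I_n}) :
  \sum_(F \in forest_triples G lt) w (ftype F) *~ fsign F
       = \sum_(mu \in [set mu | is_partition mu]%classic)
           w mu *~ (\sum_(F \in forest_triples_of_type G lt mu) fsign F).
Proof.
have fin := forest_triples_finite G lt.
set L := enum_fset (fset_set (forest_triples G lt)).
have mL F : F \in L -> forest_triples G lt F.
  by rewrite in_fset_set// inE.
(* Only the finitely many types in [M] occur; any other partition has coefficient zero. *)
pose M := undup [seq ftype F | F <- L].
transitivity (\sum_(mu <- M) w mu *~ (\sum_(F <- L | ftype F == mu) fsign F)).
  rewrite fsbig_finite// -/L.
  under [RHS]eq_bigr do rewrite mulrz_sumr big_mkcond.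
  rewrite exchange_big /=; apply: eq_big_seq => F FL.
  rewrite -big_mkcond /= (big_rem (ftype F)) /=; last by rewrite mem_undup map_f.
  rewrite eqxx big_seq_cond big1 ?addr0// => mu /andP[].
  rewrite mem_rem_uniq ?undup_uniq// => /andP[/negPf/= muF _] /eqP Fmu.
  by rewrite Fmu eqxx in muF.
under [RHS]eq_fsbigr do rewrite forest_coefE.
rewrite [LHS]fsbig_seq ?undup_uniq//; apply: fsbig_widen => mu /=.
  by rewrite mem_undup => /mapP[F /mL FT ->]; apply: ftype_partition FT.
move=> [_ muM]; rewrite big_seq_cond big1 ?mulr0z// => F /andP[FL /eqP Fmu].
by case: muM; rewrite -Fmu mem_undup map_f.
Qed.

Lemma fps_sign_coef (f : fps) k (m : monomial) :
  (f *~ (-1) ^+ k) m = (-1) ^+ k * f m.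
Proof.
by rewrite -signr_odd; case: (odd k);
  rewrite ?expr1 ?expr0 ?mulrNz ?mulr1z ?mulN1r ?mul1r.
Qed.

Lemma eq_seq_mset_partition mu nu : is_partition mu -> is_partition nu ->
  (seq_mset mu == seq_mset nu) = (mu == nu).
Proof.
move=> /andP[smu _] /andP[snu _]; apply/eqP/eqP => [e|->//].
apply: (@sorted_eq _ geq) => //.
- by move=> a b c /= ba ac; apply: leq_trans ac ba.
- by move=> a b /andP[ba ab]; apply/eqP; rewrite eqn_leq; apply/andP.
- by apply/allP => i _; apply/eqP; rewrite -!mset_seqE e.
Qed.

(* Distinct partitions index distinct monomials, so the coefficients can be   *)
(* read off the forest sum in which each e_k is replaced by a variable.       *)
Lemma forest_coef_fps n (G : simple_graph n) (lt : rel {set 'I_n}) mu :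
  is_partition mu ->
  \sum_(F \in forest_triples_of_type G lt mu) fsign F
    = (\sum_(F \in forest_triples G lt)
         (\prod_(k <- ftype F) 'x_k) *~ fsign F) (seq_mset mu).
Proof.
move=> mup; have fin := forest_triples_finite G lt.
rewrite forest_coefE [in RHS]fsbig_finite// sum_fpsE big_mkcond.
apply: eq_big_seq => F; rewrite in_fset_set// inE => FT.
rewrite fps_sign_coef prod_fps_var eq_seq_mset_partition ?(ftype_partition FT)// eq_sym.
by case: eqP; rewrite ?mulr1 ?mulr0.
Qed.

Theorem theorem5p10 (n : nat) (G : simple_graph n) :
  (forall lt : rel {set 'I_n}, strict_total_on (edges G) lt ->
     chromatic_sf G
       = \sum_(F \in forest_triples G lt) esym_part (ftype F) *~ fsign F
     /\
     \sum_(F \in forest_triples G lt) esym_part (ftype F) *~ fsign F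
       = \sum_(mu \in [set mu | is_partition mu]%classic)
           esym_part mu *~
             (\sum_(F \in forest_triples_of_type G lt mu) fsign F))
  /\
  (forall lt lt' : rel {set 'I_n},
     strict_total_on (edges G) lt -> strict_total_on (edges G) lt' ->
     forall mu : seq nat, is_partition mu ->
       \sum_(F \in forest_triples_of_type G lt mu) fsign F
         = \sum_(F \in forest_triples_of_type G lt' mu) fsign F).
Proof.
split=> [lt ltE|lt lt' ltE ltE' mu mup].
  split; [exact: chromatic_forest_expansion | exact: forest_sum_by_type].
(* With the variables ['x_k] as weights, both coefficients are read off the same order-free sum. *)
by rewrite !forest_coef_fps// !forest_sum.
Qed.
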